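(* Fix $\beta\in(0,1)$. Then there exist $\gamma_\beta<0$ and a stationary Markov policy $u\in\Pi'$ such that $u\in\Pi^*(\beta,\gamma)$ for every $\gamma\in[\gamma_\beta,0]$. Respectively, there exist $\gamma_\beta>0$ and a stationary Markov policy $u\in\Pi'$ such that $u\in\Pi^*(\beta,\gamma)$ for every $\gamma\in[0,\gamma_\beta]$.
   Context: Setting (finite discounted risk-sensitive MDP). $E=\{x_1,\dots,x_k\}$ is a finite state space and $U=\{\tilde u_1,\dots,\tilde u_l\}$ a finite action space (both nonempty); every action is available in every state. For $a\in U$, $P^a=[p_a(x_i,x_j)]_{i,j=1}^k$ is a transition probability matrix. $c\colon E\times U\to\mathbb{R}$ is a fixed running reward. $(X_n)_{n\ge 0}$ is the canonical state process. A policy is a sequence $\pi=(a_n)_{n\ge0}$, where $a_n$ is a $U$-valued function of $(X_0,\dots,X_n)$; $\Pi$ is the set of all policies. $\mathbb{E}_x^\pi$ is the expectation under the law of the process with $X_0=x$ and $\mathbb{P}(X_{n+1}=y\mid X_0,\dots,X_n)=p_{a_n}(X_n,y)$. $\Pi''\subset\Pi$ is the set of Markov policies, identified with sequences $(u_n)_{n\ge0}$, $u_n\colon E\to U$, via $a_n=u_n(X_n)$. $\Pi'\subset\Pi''$ is the set of stationary Markov policies, identified with functions $u\colon E\to U$, via $a_n=u(X_n)$ for all $n$. For $\gamma\in\mathbb{R}$, $\beta\in(0,1)$, $x\in E$, $\pi=(a_i)_{i\ge 0}\in\Pi$, put $$J_\gamma(x,\pi;\beta):=\begin{cases}\frac1\gamma\ln\mathbb{E}_x^\pi\big[e^{\gamma\sum_{i=0}^\infty\beta^i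 c(X_i,a_i)}\big],&\gamma\ne0,\\ \mathbb{E}_x^\pi\big[\sum_{i=0}^\infty\beta^i c(X_i,a_i)\big],&\gamma=0.\end{cases}$$ $\Pi^*(\beta,\gamma)$ is the set of Markov policies $\pi\in\Pi''$ that are optimal for every starting point, i.e. $J_\gamma(x,\pi;\beta)=\sup_{\pi'\in\Pi}J_\gamma(x,\pi';\beta)$ for all $x\in E$. *)

(* Defs.v *)
From HB Require Import structures.
From mathcomp Require Import all_boot all_order all_algebra.
From mathcomp Require Import all_classical all_reals all_analysis.
From mathcomp Require Import lra.

Set Implicit Arguments.
Unset Strict Implicit.
Unset Printing Implicit Defensive.

Import Order.TTheory GRing.Theory Num.Theory.
Import numFieldNormedType.Exports.

Local Open Scope classical_set_scope.
Local Open Scope ring_scope.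

(* Conventions: the state space is 'I_k.+1 and the action space is 'I_l.+1
   (arbitrary nonempty finite sets, enumerated from 0), and [P a x y] is the
   probability of moving from x to y under the action a. *)

Definition stochastic (R : realType) (k l : nat)
    (P : 'I_l.+1 -> 'M[R]_k.+1) : Prop :=
  forall a x, (forall y, 0 <= P a x y) /\ \sum_y P a x y = 1.

HB.instance Definition _ (k : nat) := isPointed.Build 'I_k.+1 ord0.

Definition coordinate_events (k : nat) : set (set (nat -> 'I_k.+1)) :=
  [set A | exists n y, A = [set w | w n = y]].

(* The canonical space E^N, with the sigma-algebra generated by the
   coordinate maps; the canonical process is X_n(w) = w n. *)
Definition trajectory (k : nat) := g_sigma_algebraType (@coordinate_events k).

Section MDP.
Variables (R : realType) (k l : nat).
Implicit Types (w : nat -> 'I_k.+1) (x y : 'I_k.+1).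

Definition history (n : nat) := n.+1.-tuple 'I_k.+1.

Definition past n w : history n := [tuple w i | i < n.+1].

Definition policy := forall n, history n -> 'I_l.+1.

Definition markov (u : nat -> 'I_k.+1 -> 'I_l.+1) : policy :=
  fun n h => u n (tnth h ord_max).

Definition stationary (u : 'I_k.+1 -> 'I_l.+1) : policy :=
  markov (fun=> u).

Definition action (pi : policy) n w : 'I_l.+1 := pi n (past n w).

(* The controlled process started at x:
   P(X_{n+1} = y | X_0, ..., X_n) = p_{a_n}(X_n, y), with the conditional
   probability multiplied out so that null histories need no special case. *)
Definition is_law (P : 'I_l.+1 -> 'M[R]_k.+1) x (pi : policy)
    (mu : probability (trajectory k) R) : Prop :=
  mu [set w | w 0%N = x] = 1%E /\
  forall n (h : history n) y,
    mu [set w | past n w = h /\ w n.+1 = y] =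
    (mu [set w | past n w = h] * (P (pi n h) (tnth h ord_max) y)%:E)%E.

(* For a stochastic P the law exists and is unique on measurable sets
   (lemmas law_spec and law_unique); otherwise [get] returns an arbitrary
   probability. *)
Definition law (P : 'I_l.+1 -> 'M[R]_k.+1) x (pi : policy) :
    probability (trajectory k) R :=
  get [set mu | is_law P x pi mu].

Definition total_reward (c : 'I_k.+1 -> 'I_l.+1 -> R) (beta : R)
    (pi : policy) w : R :=
  limn (series (fun i => beta ^+ i * c (w i) (action pi i w))).

Definition J (P : 'I_l.+1 -> 'M[R]_k.+1) (c : 'I_k.+1 -> 'I_l.+1 -> R)
    (gamma : R) x (pi : policy) (beta : R) : R :=
  if gamma == 0 then fine 'E_(law P x pi)[total_reward c beta pi]
  else gamma^-1 *
    ln (fine 'E_(law P x pi)[fun w => expR (gamma * total_reward c beta pi w)]).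

(* Pi*(beta, gamma); the supremum is over all history-dependent policies and
   is taken in the extended reals, where it always exists. *)
Definition optimal_markov (P : 'I_l.+1 -> 'M[R]_k.+1)
    (c : 'I_k.+1 -> 'I_l.+1 -> R) (beta gamma : R) : set policy :=
  [set pi | (exists u, pi = markov u) /\
    forall x, (J P c gamma x pi beta)%:E =
      ereal_sup [set (J P c gamma x pi' beta)%:E | pi' in [set: policy]]].

End MDP.

(* Existence of the law: the process is simulated from one uniform variable
   on [0, 1[, by splitting at each step the current interval according to the
   row of the transition matrix. *)
Section law_existence.
Variables (R : realType) (k l : nat) (P : 'I_l.+1 -> 'M[R]_k.+1).
Hypothesis P_stochastic : stochastic P.
Variables (pi : policy k l) (x : 'I_k.+1).

Let P_ge0 a z y : 0 <= P a z y.
Proof. by have [] := P_stochastic a z. Qed.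

Let cum a z (y : 'I_k.+1) : R := \sum_(i < k.+1 | (i < y)%N) P a z i.

Let cum_ge0 a z y : 0 <= cum a z y.
Proof. by apply: sumr_ge0. Qed.

Let cum_le a z (y : 'I_k.+1) (Q : pred 'I_k.+1) :
  (forall i : 'I_k.+1, (i <= y)%N -> Q i) ->
  cum a z y + P a z y <= \sum_(i | Q i) P a z i.
Proof.
move=> yQ; rewrite [leRHS](bigD1 y) ?yQ //= [leLHS]addrC lerD2l.
rewrite [leRHS](bigID (fun i : 'I_k.+1 => (i < y)%N)) /=.
rewrite -[leLHS]addr0; apply: lerD; last exact: sumr_ge0.
rewrite le_eqVlt; apply/orP; left; apply/eqP; apply: eq_bigl => i.
rewrite -val_eqE /=; case: (ltngtP i y) => [iy||]; rewrite ?andbT ?andbF //.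
by rewrite yQ // ltnW.
Qed.

Let cumS_le1 a z y : cum a z y + P a z y <= 1.
Proof. by have [_ <-] := P_stochastic a z; exact: cum_le. Qed.

Let cum_lt a z (y y' : 'I_k.+1) : (y < y')%N ->
  cum a z y + P a z y <= cum a z y'.
Proof. by move=> yy'; apply: cum_le => i /leq_ltn_trans; exact. Qed.

Let in_slot a z (s : R) (y : 'I_k.+1) : bool :=
  (cum a z y <= s < cum a z y + P a z y).

Let next a z (s : R) : 'I_k.+1 := odflt ord0 [pick y | in_slot a z s y].

Let slot_exists a z s : 0 <= s < 1 -> exists y, in_slot a z s y.
Proof.
move=> /andP[s0 s1]; apply: contrapT => nex.
have H : forall n, (n <= k.+1)%N ->
    \sum_(i < k.+1 | (i < n)%N) P a z i <= s.
  elim=> [|n IH] nk; first by rewrite big_pred0.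
  have cs := IH (ltnW nk).
  pose y : 'I_k.+1 := Ordinal nk.
  rewrite (bigD1 y) ?ltnSn //= addrC.
  rewrite (eq_bigl (fun i : 'I_k.+1 => (i < y)%N)); last first.
    move=> i; rewrite ltnS -val_eqE /=.
    by case: (ltngtP i n).
  rewrite leNgt; apply/negP => sc.
  by apply: nex; exists y; apply/andP.
have := H k.+1 (leqnn _).
rewrite (eq_bigl xpredT) => [|i]; last by rewrite ltn_ord.
by have [_ ->] := P_stochastic a z; rewrite leNgt s1.
Qed.

Let slot_unique a z s y y' : in_slot a z s y -> in_slot a z s y' -> y = y'.
Proof.
move=> /andP[a1 b1] /andP[a2 b2]; apply/val_inj/eqP => /=.
by case: (ltngtP y y') => // /(cum_lt a z) h; exfalso; lra.
Qed.

Let nextP a z s y : in_slot a z s y -> next a z s = y.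
Proof.
move=> sy; rewrite /next; case: pickP => [y' /= sy'|/(_ y)]; last by rewrite sy.
exact: slot_unique sy' sy.
Qed.

Let next_slot a z s : 0 <= s < 1 -> in_slot a z s (next a z s).
Proof. by move=> /(slot_exists a z)[y sy]; rewrite (nextP sy). Qed.

Fixpoint simulate (n : nat) (t : R) : history k n * R :=
  if n is m.+1 then
    let: (h, s) := simulate m t in
    let a := pi h in let z := tnth h ord_max in
    let y := next a z s in
    (rcons_tuple h y, (s - cum a z y) / P a z y)
  else ([tuple x], t).

Let piece n (h : history k n) (A L : R) :=
  [/\ 0 <= A, 0 <= L, A + L <= 1 & forall t, 0 <= t < 1 ->
      ((simulate n t).1 = h <-> A <= t < A + L) /\
      ((simulate n t).1 = h ->
        t = A + L * (simulate n t).2 /\ 0 <= (simulate n t).2 < 1)].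

Let piece0 : piece ([tuple x] : history k 0) 0 1.
Proof. by split; rewrite ?add0r // => t t01; rewrite /= mul1r add0r. Qed.

Let rcons_tuple_inj n (h h' : history k n) (y y' : 'I_k.+1) :
  rcons_tuple h y = rcons_tuple h' y' -> h = h' /\ y = y'.
Proof.
move=> /(congr1 (@tval _ _)) /= /rcons_inj[hh' ->]; split=> //.
exact: val_inj.
Qed.

Let pieceS n (h : history k n) A L y : piece h A L ->
  piece (rcons_tuple h y : history k n.+1)
    (A + L * cum (pi h) (tnth h ord_max) y)
    (L * P (pi h) (tnth h ord_max) y).
Proof.
set a := pi h; set z := tnth h ord_max.
move=> [A0 L0 AL1 H].
have c0 := cum_ge0 a z y; have p0 := P_ge0 a z y; have c1 := cumS_le1 a z y.
have Lc := mulr_ge0 L0 c0; have Lp := mulr_ge0 L0 p0.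
have Lcp : L * cum a z y + L * P a z y <= L.
  by rewrite -mulrDr -[leRHS]mulr1 ler_wpM2l.
split; [lra|lra|lra|move=> t t01].
have [Hiff Hres] := H t t01.
case E : (simulate n t) Hiff Hres => [h' s] /= Hiff Hres; rewrite E /=.
have fwd : rcons_tuple h' (next (pi h') (tnth h' ord_max) s) = rcons_tuple h y ->
   [/\ h' = h, 0 < L, in_slot a z s y, t = A + L * s &
      next (pi h') (tnth h' ord_max) s = y].
  move=> /rcons_tuple_inj[hh]; rewrite hh -/a -/z => ny.
  have [ts s01] := Hres hh.
  have /andP[? ?] := Hiff.1 hh.
  by split => //; [lra | rewrite -ny; exact: next_slot].
split.
  split => [/fwd[hh Lgt0 /andP[s1 s2] -> _]|/andP[t1 t2]].
    by rewrite -addrA -mulrDr lerD2l ler_wpM2l //= ltrD2l ltr_pM2l.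
  have hh : h' = h by apply: Hiff.2; apply/andP; split; lra.
  have [ts s01] := Hres hh.
  have Lgt0 : 0 < L.
    rewrite lt_neqAle L0 andbT; apply/eqP => L00.
    by move: t1 t2; rewrite -L00 !mul0r !addr0; lra.
  rewrite hh -/a -/z; congr rcons_tuple; apply: nextP; apply/andP; split.
    by move: t1; rewrite ts lerD2l ler_pM2l.
  by move: t2; rewrite ts -addrA -mulrDr ltrD2l ltr_pM2l.
move=> /fwd[hh Lgt0 /andP[s1 s2] ts ny].
rewrite ny hh -/a -/z.
have pgt0 : 0 < P a z y by lra.
split; last first.
  by rewrite divr_ge0 ?subr_ge0 //= ltr_pdivrMr // mul1r; lra.
by rewrite -mulrA [_ * (_ / _)]mulrC divfK ?gt_eqF // mulrBr ts; lra.
Qed.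

Let belast_history n (h : history k n.+1) :
  exists (h' : history k n) y, h = rcons_tuple h' y.
Proof.
case: h => s /= sz; case/lastP: s sz => // s y sz.
have sz' : size s == n.+1 by move: sz; rewrite size_rcons eqSS.
by exists (Tuple sz'), y; apply: val_inj.
Qed.

Let piece_ex n (h : history k n) : exists A L, piece h A L.
Proof.
elim: n h => [|n IH] h; last first.
  have [h' [y ->]] := belast_history h.
  have [A [L /pieceS HL]] := IH h'.
  by do 2 eexists; exact: HL.
have [->|hx] := eqVneq h [tuple x]; first by exists 0, 1.
exists 0, 0; split => //; rewrite ?addr0 // => t t01 /=.
split; last by move/esym/eqP; rewrite (negbTE hx).
split; first by move/esym/eqP; rewrite (negbTE hx).
by move=> ?; exfalso; lra.
Qed.

Let cut (t : R) : R := if 0 <= t < 1 then t else 0.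

Definition simulated_path (t : R) : trajectory k :=
  fun n => tnth (simulate n (cut t)).1 ord_max.

Let tnth_rcons n (h : history k n) y (i : 'I_n.+2) :
  tnth (rcons_tuple h y) i = if (i < n.+1)%N then nth y h i else y.
Proof.
by rewrite (tnth_nth y) /= nth_rcons size_tuple if_same.
Qed.

Let past_simulated n t : past n (simulated_path t) = (simulate n (cut t)).1.
Proof.
apply: eq_from_tnth => i; rewrite tnth_mktuple /simulated_path.
elim: n i => [|n IH] i; first by rewrite (ord1 i).
have [iS|iS] := ltnP i n.+1; last first.
  have -> : i = ord_max by apply/val_inj/eqP; rewrite eqn_leq iS -ltnS ltn_ord.
  by [].
rewrite (IH (Ordinal iS)) /=.
case: (simulate n (cut t)) => h s /=; rewrite tnth_rcons iS.
by rewrite (tnth_nth (next (pi h) (tnth h ord_max) s)).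
Qed.

Let unit_itv : set R := `[0, 1[%classic.

Let cutE t : unit_itv t -> cut t = t.
Proof. by rewrite /unit_itv /= in_itv /= /cut => ->. Qed.

Let cut_piece n (h : history k n) A L t : piece h A L ->
  (simulate n (cut t)).1 = h <-> A <= cut t < A + L.
Proof.
move=> [_ _ _ /(_ (cut t))]; case; last by [].
by rewrite /cut; case: ifPn => // _; rewrite lexx ltr01.
Qed.

Let measurable_cut : measurable_fun [set: R] cut.
Proof.
rewrite (_ : cut = fun t => if t \in unit_itv then t else 0); last first.
  by apply/funext => t; rewrite /cut mem_setE /= in_itv.
apply: measurable_fun_ifT => //.
by apply: (measurable_fun_bool true); rewrite setTI (_ : _ @^-1` _ = unit_itv);
  [exact: measurable_itv | apply/seteqP; split => t /=; [move/set_mem|move/mem_set]].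
Qed.

Let measurable_simulated_past n (h : history k n) :
  measurable [set t | past n (simulated_path t) = h].
Proof.
have [A [L AL]] := piece_ex h.
rewrite (_ : [set _ | _] = cut @^-1` `[A, A + L[%classic).
  by rewrite -[X in measurable X]setTI; exact: measurable_cut.
apply/seteqP; split => t /=; rewrite past_simulated in_itv /=.
  by move/(cut_piece _ AL).
by move=> /(cut_piece _ AL).
Qed.

Let measurable_simulated : measurable_fun [set: R] simulated_path.
Proof.
refine (@measurability _ _ _ _ setT simulated_path (@coordinate_events k) _ _) => //.
move=> _ [_ [n [y ->]] <-]; rewrite setTI.
rewrite (_ : _ @^-1` _ = \bigcup_(h in [set h | tnth h ord_max = y])
    [set t | past n (simulated_path t) = h]).
  by apply: fin_bigcup_measurable => [|h _]; [exact: finite_finset|].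
apply/seteqP; split => [t /= ty|t [h /= hy th] /=].
  by exists (past n (simulated_path t)) => //=; rewrite tnth_mktuple.
by rewrite -hy -th tnth_mktuple.
Qed.

Let sim : measurableTypeR R -> trajectory k := simulated_path.

#[local] HB.instance Definition _ :=
  isMeasurableFun.Build _ _ _ _ sim measurable_simulated.

Let measurable_unit : measurable unit_itv := measurable_itv _.

Let uniform01 := mrestr (@lebesgue_measure R) measurable_unit.

Let uniform01_setT : uniform01 [set: R] = 1%E.
Proof.
rewrite /uniform01 /mrestr setTI /unit_itv lebesgue_measure_itv /= lte_fin ltr01.
by rewrite sube0.
Qed.

#[local] HB.instance Definition _ := Measure.on uniform01.
#[local] HB.instance Definition _ :=
  Measure_isProbability.Build _ _ _ uniform01 uniform01_setT.

Let mu : probability (trajectory k) R :=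
  distribution uniform01 sim.

Let mu_past n (h : history k n) A L : piece h A L ->
  mu [set w | past n w = h] = L%:E.
Proof.
move=> AL; rewrite /mu /distribution /pushforward /= /uniform01 /mrestr.
rewrite (_ : _ `&` _ = `[A, A + L[%classic).
  have [_ L0 _ _] := AL.
  rewrite lebesgue_measure_itv /= lte_fin.
  case: ifPn => [_|]; first by rewrite -EFinB addrAC subrr add0r.
  rewrite -leNgt => ?; congr EFin; lra.
apply/seteqP; split => t /=.
  move=> [+ t01]; rewrite past_simulated => /(cut_piece _ AL).
  by rewrite cutE // in_itv.
have [A0 _ AL1 _] := AL.
rewrite in_itv /= => tA.
have t01 : unit_itv t.
  by rewrite /unit_itv /= in_itv /=; move: tA => /andP[? ?]; apply/andP; split; lra.
by split => //; rewrite past_simulated; apply/(cut_piece _ AL); rewrite cutE.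
Qed.

Lemma is_law_ex : exists nu, is_law P x pi nu.
Proof.
exists mu; split.
  rewrite (_ : [set _ | _] = [set w | past 0 w = [tuple x]]).
    by rewrite (mu_past piece0).
  apply/seteqP; split => w /=.
    by move=> wx; apply: eq_from_tnth => i; rewrite tnth_mktuple (ord1 i).
  by move/(congr1 (fun h => tnth h ord0)); rewrite tnth_mktuple.
move=> n h y.
have [A [L AL]] := piece_ex h.
rewrite (mu_past AL) -EFinM -(mu_past (pieceS y AL)); congr (_ _).
apply/seteqP; split => w /=.
  move=> [wh wy]; apply: eq_from_tnth => i; rewrite tnth_mktuple tnth_rcons.
  case: ifPn => [iS|]; last first.
    rewrite -leqNgt => ni; rewrite -wy; congr w.
    by apply/eqP; rewrite eqn_leq ni andbT -ltnS.
  by rewrite -wh (_ : i = Ordinal iS :> nat) // -tnth_nth tnth_mktuple.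
move=> wh; split; last first.
  have := congr1 (fun h' => tnth h' ord_max) wh.
  by rewrite tnth_mktuple tnth_rcons /= ltnn.
apply: eq_from_tnth => i; rewrite tnth_mktuple.
have := congr1 (fun h' => tnth h' (widen_ord (leqnSn _) i)) wh.
by rewrite tnth_mktuple tnth_rcons /= ltn_ord -tnth_nth.
Qed.

Lemma law_spec : is_law P x pi (law P x pi).
Proof. exact: getPex is_law_ex. Qed.

End law_existence.

Lemma measurable_past (k n : nat) (h : history k n) :
  measurable ([set w | past n w = h] : set (trajectory k)).
Proof.
have -> : [set w | past n w = h] =
    \bigcap_(i in [set: 'I_n.+1]) [set w | w i = tnth h i] :> set (trajectory k).
  apply/seteqP; split => w /=; first by move=> <- i _ /=; rewrite tnth_mktuple.
  by move=> wh; apply: eq_from_tnth => i; rewrite tnth_mktuple; exact: wh.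
apply: fin_bigcap_measurable => [|i _]; first exact: finite_finset.
by apply: sub_sigma_algebra; exists i, (tnth h i).
Qed.

Section law_uniqueness.
Variables (R : realType) (k l : nat) (P : 'I_l.+1 -> 'M[R]_k.+1).
Variables (pi : policy k l) (x : 'I_k.+1).

Let cylinders : set (set (trajectory k)) :=
  [set A | A = set0 \/ A = setT \/ exists n (h : history k n),
    A = [set w | past n w = h]].

Let cylinder_setI n m (h : history k n) (h' : history k m) : (n <= m)%N ->
  cylinders ([set w | past n w = h] `&` [set w | past m w = h']).
Proof.
rewrite -ltnS => nm.
have trunc w : past n w = [tuple tnth (past m w) (widen_ord nm i) | i < n.+1].
  by apply: eq_from_tnth => i; rewrite !tnth_mktuple.
pose g := [tuple tnth h' (widen_ord nm i) | i < n.+1].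
have [gh|gh] := eqVneq g h.
  right; right; exists m, h'; apply/seteqP; split => w /=; first by case.
  by move=> wh'; split => //; rewrite trunc wh'.
left; apply/seteqP; split => // w /= [wh wh'].
by move/eqP: gh; apply; rewrite -wh trunc wh'.
Qed.

Lemma law_unique (mu nu : probability (trajectory k) R) :
  is_law P x pi mu -> is_law P x pi nu ->
  forall A, measurable A -> mu A = nu A.
Proof.
move=> [mu0 muS] [nu0 nuS].
have past0 w (h : history k 0) : past 0 w = h <-> w 0%N = tnth h ord0.
  split=> [<-|wh]; first by rewrite tnth_mktuple.
  by apply: eq_from_tnth => i; rewrite tnth_mktuple (ord1 i).
have start (la : probability (trajectory k) R) (h : history k 0) :
    la [set w | w 0%N = x] = 1%E ->
    la [set w | past 0 w = h] = ((tnth h ord0 == x)%:R)%:E.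
  have [hx la0|hx la0] := eqVneq (tnth h ord0) x.
    rewrite -la0; congr (la _); apply/seteqP; split => w /=.
      by move/past0; rewrite hx.
    by rewrite -hx => /past0.
  have mx : measurable ([set w | w 0%N = x] : set (trajectory k)).
    by apply: sub_sigma_algebra; exists 0%N, x.
  apply/eqP; rewrite eq_le measure_ge0 andbT.
  rewrite (_ : 0%:E = la (~` [set w | w 0%N = x])); last first.
    by rewrite probability_setC // la0 subee.
  apply: le_measure; rewrite ?inE; [exact: measurable_past|exact: measurableC|].
  by move=> w /= /past0 -> hx'; rewrite hx' eqxx in hx.
have agree n (h : history k n) :
    mu [set w | past n w = h] = nu [set w | past n w = h].
  elim: n h => [|n IH] h; first by rewrite !start.
  pose h' : history k n := [tuple tnth h (widen_ord (leqnSn _) i) | i < n.+1].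
  rewrite (_ : [set _ | _] =
      [set w | past n w = h' /\ w n.+1 = tnth h ord_max]).
    by rewrite muS nuS IH.
  apply/seteqP; split => w /=.
    move=> wh; rewrite /h' -wh tnth_mktuple; split => //.
    by apply: eq_from_tnth => i; rewrite !tnth_mktuple.
  move=> [wh' wn]; apply: eq_from_tnth => i; rewrite tnth_mktuple.
  have [iS|iS] := ltnP i n.+1; last first.
    have -> : i = ord_max by apply/val_inj/eqP; rewrite eqn_leq iS -ltnS ltn_ord.
    exact: wn.
  have := congr1 (fun h0 => tnth h0 (Ordinal iS)) wh'.
  by rewrite !tnth_mktuple /= => ->; congr tnth; exact: val_inj.
have Gm : cylinders `<=` measurable.
  by move=> _ [->|[->|[n [h ->]]]] //; exact: measurable_past.
move=> A mA; apply: (g_sigma_algebra_measure_unique cylinders Gm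
  (fun=> setT)).
- by move=> _; right; left.
- by rewrite bigcup_const //; exists 0%N.
- move=> B C [->|[->|[n [h ->]]]]; [by rewrite set0I; left| by rewrite setTI|].
  move=> [->|[->|[m [h' ->]]]]; [by rewrite setI0; left| |].
    by rewrite setIT; right; right; exists n, h.
  have [nm|/ltnW mn] := leqP n m; first exact: cylinder_setI.
  by rewrite setIC; exact: cylinder_setI.
- move=> B [->|[->|[n [h ->]]]]; [by rewrite !measure0| |exact: agree].
  exact: etrans (probability_setT mu) (esym (probability_setT nu)).
- move=> _; apply: le_lt_trans (ltry 1).
  by rewrite -[leRHS](probability_setT mu).
- move: A mA; apply: smallest_sub.
    exact: smallest_sigma_algebra.
  move=> _ [n [y ->]].
  rewrite (_ : [set _ | _] = \bigcup_(h in [set h | tnth h ord_max = y])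
      [set w | past n w = h]).
    apply: (@fin_bigcup_measurable _ (g_sigma_algebraType cylinders)).
      exact: finite_finset.
    by move=> h _; apply: sub_sigma_algebra; right; right; exists n, h.
  apply/seteqP; split => [w /= wy|w [h /= hy wh] /=].
    by exists (past n w) => //=; rewrite tnth_mktuple.
  by rewrite -hy -wh tnth_mktuple.
Qed.

End law_uniqueness.

(* Main.v *)
Require Import Defs.
From mathcomp Require Import all_boot all_order all_algebra.
From mathcomp Require Import all_classical all_reals all_analysis.
From mathcomp Require Import measurable_realfun ring lra.

Set Implicit Arguments.
Unset Strict Implicit.
Unset Printing Implicit Defensive.

Import Order.TTheory GRing.Theory Num.Theory.
Import numFieldNormedType.Exports.

Local Open Scope classical_set_scope.
Local Open Scope ring_scope.

(** Write S for the total discounted reward and G_g(x, pi) for the exponential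
moment E_x^pi[exp(g S)].  For g <> 0, maximizing J_g is maximizing s G_g, where s
is the sign of g, so fix s = 1 or s = -1 and look at g = s t for small t > 0.
Every stationary policy f satisfies the recursion [mgf_stationary]
  G_g(x, f) = exp(g c(x, f x)) sum_y P(f x, x, y) G_(g beta)(y, f),
which relates the risk parameter g to g beta, not to itself.  For this reason
optimality at one g produces only a Markov policy; stationarity has to come from
comparing policies on a whole interval ]0, e] at once, which is stable under
g |-> g beta.

Such a comparison makes sense because S is bounded: G_g is an entire function of
g, hence so is, up to a positive factor, the advantage of playing the action a
once in the state x before following f.  By looking at its first nonzero Taylor
coefficient, the advantage is either nonpositive or positive on a whole right
neighbourhood of t = 0 ([advantage_sign]).  The policy iteration argument then
works at the level of germs at 0+.  If the advantage of a at x is eventually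
positive, switching f to a at x yields an eventually better stationary policy
([improvement]).  Stationary policies are finite in number, so one of them is
maximal for the preorder of germs ([eventually_maximal]), and for it all
advantages are eventually nonpositive ([eventually_optimal_equation]).  On the
resulting interval, exp(g S_n) G_(g beta^n)(X_n, f) is, up to the sign s, a
supermartingale under every history-dependent policy, where S_n is the reward of
the first n steps; as n grows it tends to exp(g S), and optimality of f follows
([verification]).

At g = 0, the inequality between the exponential moments of two policies for
small t forces the same inequality between their first-order coefficients, the
expectations of S ([mean_le_of_mgf_le]). *)

(** * Analytic germs at 0+ *)

Section germs.
Variable R : realType.
Implicit Types (D : R -> R) (a : nat -> R).

Lemma near_rightP (P : R -> Prop) :
  (\forall t \near 0^'+, P t) <->
  exists2 e : R, 0 < e & forall t, 0 < t <= e -> P t.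
Proof.
split=> [[/= e e0 He]|[e e0 He]].
  exists (e / 2) => [|t /andP[t0 te]]; first by rewrite divr_gt0.
  apply: He => //=; rewrite sub0r normrN gtr0_norm //; lra.
near=> t; apply: He; apply/andP; split => //.
near: t; exact: nbhs_right_le.
Unshelve. all: by end_near. Qed.

(** Convergent power series with a geometric remainder bound.  The single
constant C plays both roles, amplitude and inverse radius, so that bounds
combine by enlarging it. *)
Definition expands D a := exists2 C, 0 <= C &
  forall n t, `|t| <= 1 ->
    `|D t - \sum_(j < n) a j * t ^+ j| <= C * (C * `|t|) ^+ n.

Lemma expandsD D1 D2 a1 a2 : expands D1 a1 -> expands D2 a2 ->
  expands (fun t => D1 t + D2 t) (fun j => a1 j + a2 j).
Proof.
move=> [C1 C10 H1] [C2 C20 H2]; exists (C1 + C2); first exact: addr_ge0.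
move=> n t t1.
under eq_bigr do rewrite mulrDl.
rewrite big_split /= opprD addrACA (le_trans (ler_normD _ _)) //.
rewrite mulrDl lerD //; [apply: le_trans (H1 n t t1) _|apply: le_trans (H2 n t t1) _].
all: rewrite ler_wpM2l // lerXn2r ?nnegrE ?mulr_ge0 ?addr_ge0 //.
all: by rewrite ler_wpM2r // (lerDl, lerDr).
Qed.

Lemma expandsZ r D a : expands D a ->
  expands (fun t => r * D t) (fun j => r * a j).
Proof.
move=> [C C0 H]; have r0 := normr_ge0 r.
exists (C * (`|r| + 1)); first by rewrite mulr_ge0 ?addr_ge0.
move=> n t t1.
under eq_bigr do rewrite -mulrA.
rewrite -mulr_sumr -mulrBr normrM.
apply: le_trans (_ : `|r| * (C * (C * `|t|) ^+ n) <= _).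
  by rewrite ler_wpM2l // H.
rewrite mulrA ler_pM ?mulr_ge0 ?exprn_ge0 ?mulr_ge0 //.
  by rewrite [leRHS]mulrDr mulr1 mulrC lerDl.
rewrite lerXn2r ?nnegrE ?mulr_ge0 ?addr_ge0 // ler_wpM2r //.
by rewrite mulrDr mulr1 lerDr mulr_ge0.
Qed.

Lemma expands_dilate r D a : `|r| <= 1 -> expands D a ->
  expands (fun t => D (r * t)) (fun j => a j * r ^+ j).
Proof.
move=> r1 [C C0 H]; exists C => // n t t1.
have rt : `|r * t| <= `|t| by rewrite normrM ler_piMl.
under eq_bigr do rewrite -mulrA -exprMn.
apply: le_trans (H n (r * t) (le_trans rt t1)) _.
by rewrite ler_wpM2l // lerXn2r ?nnegrE ?mulr_ge0 // ler_wpM2l.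
Qed.

Definition expandable D := exists a, expands D a.

Lemma expandable_sum (I : finType) (D : I -> R -> R) :
  (forall i, expandable (D i)) -> expandable (fun t => \sum_i D i t).
Proof.
move=> HD; elim: index_enum => [|i s [a Ha]].
  exists (fun=> 0), 0 => // n t _; rewrite !big_nil big1 ?subr0 ?normr0 ?mul0r//.
  by move=> j _; rewrite mul0r.
have [b Hb] := HD i; exists (fun j => b j + a j).
rewrite (_ : (fun t => _) = fun t => D i t + \sum_(j <- s) D j t).
  exact: expandsD.
by apply/funext => t; rewrite big_cons.
Qed.

(** Near 0 the leading term dominates the remainder. *)
Lemma expands_pos D a n : expands D a ->
  (forall j, (j < n)%N -> a j = 0) -> 0 < a n ->
  \forall t \near 0^'+, 0 < D t.
Proof.
move=> [C C0 H] a0 an; apply/near_rightP.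
have K0 : 0 <= C ^+ n.+2 by exact: exprn_ge0.
(* The remainder is at most C^(n+2) t^(n+1), so t < a_n / C^(n+2) suffices; the
   added 1 avoids division by zero and the added a_n keeps e <= 1. *)
pose e := a n / (C ^+ n.+2 + 1 + a n).
have d0 : 0 < C ^+ n.+2 + 1 + a n by lra.
have e0 : 0 < e by rewrite divr_gt0.
have eE : e * (C ^+ n.+2 + 1 + a n) = a n by rewrite divfK ?gt_eqF.
exists e => // t /andP[t0 te].
have e1 : e <= 1 by rewrite ler_pdivrMr // mul1r; lra.
have := H n.+1 t; rewrite gtr0_norm // => /(_ (le_trans te e1)).
rewrite big_ord_recr /= big1 => [|j _]; last by rewrite a0 ?mul0r.
rewrite add0r (_ : C * _ = C ^+ n.+2 * t * t ^+ n); last first.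
  by rewrite exprMn !exprS; ring.
rewrite ler_norml.
move=> /andP[+ _]; rewrite lerBrDl; apply: lt_le_trans.
rewrite [X in _ < X](_ : _ = (a n - C ^+ n.+2 * t) * t ^+ n); last ring.
rewrite mulr_gt0 ?exprn_gt0 // subr_gt0.
apply: le_lt_trans (ler_wpM2l K0 te) _.
rewrite -eE mulrC ltr_pM2l //; lra.
Qed.

(** The remainder bound at all orders n excludes flat nonzero functions: for
C t < 1 it tends to 0 as n grows. *)
Lemma expands0 D a : expands D a -> (forall j, a j = 0) ->
  \forall t \near 0^'+, D t = 0.
Proof.
move=> [C C0 H] a0; apply/near_rightP.
have C2 : 0 < C + 2 by lra.
exists (C + 2)^-1; first by rewrite invr_gt0.
move=> t /andP[t0 te].
have Ct : C * t < 1.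
  apply: le_lt_trans (ler_wpM2l C0 te) _.
  by rewrite ltr_pdivrMr // mul1r; lra.
have t1 : `|t| <= 1.
  rewrite gtr0_norm // (le_trans te) // invf_le1 //; lra.
apply/eqP; rewrite -normr_eq0 eq_le normr_ge0 andbT.
have cv : (fun n => C * (C * `|t|) ^+ n) @ \oo --> C * 0.
  apply: cvgM; first exact: cvg_cst.
  apply: cvg_expr; rewrite ger0_norm ?mulr_ge0 // gtr0_norm //.
rewrite mulr0 in cv.
rewrite -(cvg_lim _ cv) //; apply: limr_ge; first by apply/cvg_ex; exists 0.
near=> n; have := H n t t1; rewrite big1 ?subr0 // => j _.
by rewrite a0 mul0r.
Unshelve. all: by end_near. Qed.

(** Analytic germs cannot oscillate: the first nonzero coefficient decides the
sign, and without one the function vanishes. *)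
Lemma expandable_sign D : expandable D ->
  (\forall t \near 0^'+, D t <= 0) \/ (\forall t \near 0^'+, 0 < D t).
Proof.
move=> [a Ha].
have [a0|] := pselect (forall j, a j = 0).
  by left; apply: filterS (expands0 Ha a0) => t ->.
move=> /existsNP[j /eqP aj].
have [n an nmin] := ex_minnP (ex_intro (fun j => a j != 0) j aj).
have a0 i : (i < n)%N -> a i = 0.
  by move=> i_n; apply: contraTeq i_n => /nmin; rewrite -leqNgt.
have [an0|an0|/eqP] := ltgtP 0 (a n).
- by right; exact: expands_pos Ha a0 an0.
- left; have := @expands_pos _ _ n (expandsZ (-1) Ha).
  rewrite mulN1r oppr_gt0 => /(_ _ an0) H.
  apply: filterS (H _) => [t|i /a0 ->]; last by rewrite mulr0.
  by rewrite mulN1r oppr_gt0 => /ltW.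
- by rewrite eq_sym (negbTE an).
Qed.

Lemma expands_slope_ge0 D a : expands D a -> a 0%N = 0 ->
  (\forall t \near 0^'+, 0 <= D t) -> 0 <= a 1%N.
Proof.
move=> Ha a0 D0; rewrite leNgt; apply/negP => a1.
have : \forall t \near 0^'+, 0 < -1 * D t.
  apply: (@expands_pos _ _ 1 (expandsZ (-1) Ha)) => [[|//] _|].
    by rewrite a0 mulr0.
  by rewrite mulN1r oppr_gt0.
move=> /(filterI D0) /near_rightP[e e0 /(_ e)].
by rewrite e0 lexx => /(_ isT)[] /= ?; lra.
Qed.

Lemma expR_remainder (x : R) n :
  `|expR x - \sum_(j < n) x ^+ j / j`!%:R| <= `|x| ^+ n * expR `|x|.
Proof.
have cv : (fun m => `|series (exp_coeff x) m - \sum_(j < n) x ^+ j / j`!%:R|)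
    @ \oo --> `|expR x - \sum_(j < n) x ^+ j / j`!%:R|.
  apply: cvg_norm; apply: cvgB; last exact: cvg_cst.
  exact: is_cvg_series_exp_coeff.
rewrite -(cvg_lim _ cv) //; apply: limr_le; first by apply/cvg_ex; eexists; exact: cv.
near=> m.
have nm : (n <= m)%N by near: m; exact: nbhs_infty_ge.
rewrite /series /= (big_cat_nat (n := n)) //= big_mkord addrAC subrr add0r.
apply: le_trans (ler_norm_sum _ _ _) _.
rewrite -{1}[n]add0n big_addn.
apply: le_trans (_ : \sum_(0 <= i < m - n) `|x| ^+ n * exp_coeff `|x| i <= _).
  apply: ler_sum => i _; rewrite /exp_coeff /= normrM normrX normfV normr_nat.
  rewrite exprD mulrA [`|x| ^+ i * _]mulrC ler_wpM2l ?mulr_ge0 ?exprn_ge0 //.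
  rewrite lef_pV2 ?posrE ?ltr0n ?fact_gt0 // ler_nat.
  by rewrite dvdn_leq ?fact_gt0 // (fact_split (leq_addr n i)) dvdn_mulr.
rewrite -mulr_sumr ler_wpM2l ?exprn_ge0 //.
apply: (nondecreasing_cvgn_le _ (is_cvg_series_exp_coeff `|x|)).
apply: nondecreasing_series => i _ _; exact: exp_coeff_ge0.
Unshelve. all: by end_near. Qed.
End germs.

(** * Bounded random variables and their exponential moments *)

Section bounded_rv.
Context d (T : measurableType d) (R : realType) (mu : probability T R).
Implicit Types (X Y : T -> R).

Definition bounded_rv X :=
  measurable_fun [set: T] X /\ exists M, forall w, `|X w| <= M.

Lemma bounded_rv_integrable X :
  bounded_rv X -> mu.-integrable [set: T] (EFin \o X).
Proof.
move=> [mX [M XM]]; apply: measurable_bounded_integrable => //.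
  by apply: le_lt_trans (ltry 1); exact: probability_le1.
exists M; split; first exact: num_real.
by move=> N MN w _; apply: le_trans (ltW MN).
Qed.

Lemma bounded_rv_cst r : bounded_rv (fun=> r).
Proof. by split=> //; exists `|r|. Qed.

Lemma bounded_rvD X Y : bounded_rv X -> bounded_rv Y ->
  bounded_rv (fun w => X w + Y w).
Proof.
move=> [mX [M XM]] [mY [N YN]]; split; first exact: measurable_funD.
by exists (M + N) => w; rewrite (le_trans (ler_normD _ _)) ?lerD.
Qed.

Lemma bounded_rvM X Y : bounded_rv X -> bounded_rv Y ->
  bounded_rv (fun w => X w * Y w).
Proof.
move=> [mX [M XM]] [mY [N YN]]; split; first exact: measurable_funM.
by exists (M * N) => w; rewrite normrM ler_pM.
Qed.

Lemma bounded_rvZ r X : bounded_rv X -> bounded_rv (fun w => r * X w).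
Proof. exact/bounded_rvM/bounded_rv_cst. Qed.

Lemma bounded_rvB X Y : bounded_rv X -> bounded_rv Y ->
  bounded_rv (fun w => X w - Y w).
Proof.
move=> bX bY; rewrite (_ : (fun w => _) = fun w => X w + -1 * Y w).
  by apply: bounded_rvD => //; exact: bounded_rvZ.
by apply/funext => w; rewrite mulN1r.
Qed.

Lemma bounded_rvX X n : bounded_rv X -> bounded_rv (fun w => X w ^+ n).
Proof.
move=> [mX [M XM]]; split; first exact: measurable_funX.
exists (M ^+ n) => w; rewrite normrX lerXn2r ?nnegrE //.
exact: le_trans (XM w).
Qed.

Lemma bounded_rv_expR X : bounded_rv X -> bounded_rv (fun w => expR (X w)).
Proof.
move=> [mX [M XM]]; split; first exact: measurableT_comp.
exists (expR M) => w; rewrite ger0_norm ?expR_ge0 // ler_expR.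
exact: le_trans (ler_norm _) (XM w).
Qed.

Lemma bounded_rv_sum (I : Type) (s : seq I) (X : I -> T -> R) :
  (forall i, bounded_rv (X i)) -> bounded_rv (fun w => \sum_(i <- s) X i w).
Proof.
move=> bX; elim: s => [|i s IH].
  by under eq_fun do rewrite big_nil; exact: bounded_rv_cst.
by under eq_fun do rewrite big_cons; exact: bounded_rvD.
Qed.

Lemma mean_cst r : \int[mu]_(w in [set: T]) r = r.
Proof.
rewrite Rintegral_cst // (_ : fine _ = 1) ?mulr1 //.
exact: (congr1 fine (probability_setT mu)).
Qed.

Lemma mean_sum (I : Type) (s : seq I) (X : I -> T -> R) :
  (forall i, bounded_rv (X i)) ->
  \int[mu]_w (\sum_(i <- s) X i w) = \sum_(i <- s) \int[mu]_w X i w.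
Proof.
move=> bX; elim: s => [|i s IH].
  by rewrite big_nil; under eq_Rintegral do rewrite big_nil; rewrite mean_cst.
rewrite big_cons -IH; under eq_Rintegral do rewrite big_cons.
rewrite RintegralD //; apply: bounded_rv_integrable => //.
exact: bounded_rv_sum.
Qed.

Lemma meanZ r X : bounded_rv X ->
  \int[mu]_w (r * X w) = r * \int[mu]_w X w.
Proof. by move=> bX; rewrite RintegralZl //; exact: bounded_rv_integrable. Qed.

Lemma meanB X Y : bounded_rv X -> bounded_rv Y ->
  \int[mu]_w (X w - Y w) = \int[mu]_w X w - \int[mu]_w Y w.
Proof.
by move=> bX bY; rewrite RintegralB //; exact: bounded_rv_integrable.
Qed.

Lemma le_mean X Y : bounded_rv X -> bounded_rv Y ->
  (forall w, X w <= Y w) -> \int[mu]_w X w <= \int[mu]_w Y w.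
Proof.
by move=> bX bY XY; apply: le_Rintegral => //; exact: bounded_rv_integrable.
Qed.

Lemma norm_mean_le X M : bounded_rv X -> (forall w, `|X w| <= M) ->
  `|\int[mu]_w X w| <= M.
Proof.
move=> bX XM; rewrite ler_norml -{1}[- M]mean_cst -{2}[M]mean_cst.
by apply/andP; split; apply: le_mean => //; try exact: bounded_rv_cst;
  move=> w; have := XM w; rewrite ler_norml => /andP[].
Qed.

(** Integrating the Taylor expansion of the exponential; the remainder is uniform
because X is bounded. *)
Lemma mgf_expands X : bounded_rv X ->
  expands (fun t => \int[mu]_w expR (t * X w))
    (fun j => \int[mu]_w (X w ^+ j) / j`!%:R).
Proof.
move=> bX; have [mX [M XM]] := bX.
pose C := expR `|M|.
have MC : `|M| <= C by apply: le_trans (expR_ge1Dx _); rewrite lerDr.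
have XM' w : `|X w| <= `|M| by exact: le_trans (XM w) (ler_norm M).
exists C => [|n t t1]; first exact: expR_ge0.
have bt : bounded_rv (fun w => expR (t * X w)).
  exact/bounded_rv_expR/bounded_rvZ.
have bj j : bounded_rv (fun w => (t * X w) ^+ j / j`!%:R).
  apply: bounded_rvM; last exact: bounded_rv_cst.
  exact/bounded_rvX/bounded_rvZ.
rewrite (_ : \sum_(j < n) _ =
    \int[mu]_w (\sum_(j < n) (t * X w) ^+ j / j`!%:R)); last first.
  rewrite mean_sum //; apply: eq_bigr => j _.
  rewrite mulrAC mulrC mulrA -meanZ; last exact: bounded_rvX.
  rewrite mulrC -meanZ; last by apply: bounded_rvZ; exact: bounded_rvX.
  by apply: eq_Rintegral => w _; rewrite exprMn -mulrA [X in _ * X]mulrC.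
rewrite -meanB //; last exact: bounded_rv_sum.
apply: norm_mean_le => [|w]; first by apply: bounded_rvB => //; exact: bounded_rv_sum.
apply: le_trans (expR_remainder _ _) _; rewrite mulrC normrM.
apply: ler_pM; rewrite ?expR_ge0 ?exprn_ge0 ?mulr_ge0 //.
  by rewrite ler_expR; apply: le_trans (XM' w); rewrite ler_piMl.
rewrite lerXn2r ?nnegrE ?mulr_ge0 ?expR_ge0 // mulrC ler_wpM2r //.
exact: le_trans (XM' w) MC.
Qed.

Section finitely_valued.
Variables (I : finType) (Y : T -> I) (F : I -> R).
Hypothesis mY : forall i, measurable (Y @^-1` [set i]).

Let A i := Y @^-1` [set i].

Let FYE : (fun w => F (Y w)) = fun w => \sum_i F i * \1_(A i) w.
Proof.
apply/funext => w; rewrite (bigD1 (Y w)) //= big1 ?addr0.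
  by rewrite indicE mem_set ?mulr1.
by move=> i iY; rewrite indicE memNset ?mulr0 // => /= /eqP; rewrite eq_sym (negbTE iY).
Qed.

Let bounded_term i : bounded_rv (fun w => F i * \1_(A i) w).
Proof.
apply: bounded_rvZ; split; first exact: measurable_indic (mY i).
by exists 1 => w; rewrite indicE; case: (_ \in _); rewrite ?normr1 ?normr0.
Qed.

Lemma bounded_rv_finite : bounded_rv (fun w => F (Y w)).
Proof. by rewrite FYE; exact: bounded_rv_sum. Qed.

Lemma mean_finite :
  \int[mu]_w F (Y w) = \sum_i F i * fine (mu (Y @^-1` [set i])).
Proof.
rewrite FYE mean_sum //; apply: eq_bigr => i _; rewrite RintegralZl //.
  by rewrite /Rintegral integral_indic ?setIT //; exact: mY.
exact: integrable_indic (mY i).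
Qed.

End finitely_valued.

End bounded_rv.

(** * One step of the controlled process *)

Section process.
Variables (R : realType) (k l : nat) (P : 'I_l.+1 -> 'M[R]_k.+1).
Hypothesis P_stochastic : stochastic P.
Implicit Types (w : trajectory k) (F : trajectory k -> R) (H : 'I_k.+1 -> R).

(** Functions of (X_0, ..., X_n) are encoded as functions of the trajectory, which
avoids transporting running rewards to tuples of varying length. *)
Definition adapted n F := forall w w',
  (forall i, (i <= n)%N -> w i = w' i) -> F w = F w'.

Lemma nth_past n w i : (i <= n)%N -> nth ord0 (past n w) i = w i.
Proof.
rewrite -ltnS => i_n.
by rewrite -(tnth_nth ord0 (past n w) (Ordinal i_n)) tnth_mktuple.
Qed.

Lemma adapted_past n F w : adapted n F -> F w = F (nth ord0 (past n w)).
Proof. by apply=> i i_n; rewrite nth_past. Qed.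

Lemma tnth_past_max n w : tnth (past n w) ord_max = w n.
Proof. by rewrite tnth_mktuple. Qed.

Variables (pi : policy k l) (x : 'I_k.+1).
Let mu := law P x pi.
Let muP : is_law P x pi mu := law_spec P_stochastic pi x.

Lemma action_adapted n i w w' : (i <= n)%N ->
  (forall j, (j <= n)%N -> w j = w' j) -> action pi i w = action pi i w'.
Proof.
move=> i_n ww'; rewrite /action (_ : past i w = past i w') //.
apply: eq_from_tnth => j; rewrite !tnth_mktuple ww' //.
by apply: leq_trans i_n; rewrite -ltnS.
Qed.

Lemma measurable_coordinate n (y : 'I_k.+1) :
  measurable ([set w | w n = y] : set (trajectory k)).
Proof. by apply: sub_sigma_algebra; exists n, y. Qed.

Lemma bounded_adapted n F : adapted n F -> bounded_rv F.
Proof.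
move=> aF; rewrite (_ : F = fun w => F (nth ord0 (past n w))); last first.
  by apply/funext => w; exact: adapted_past.
apply: (bounded_rv_finite (fun h : history k n => F (nth ord0 h))) => h.
exact: measurable_past.
Qed.

(** The Markov property, integrated: conditioning X_(n+1) on the history replaces
H by its average over the transition chosen by the policy. *)
Lemma mean_step n F H : adapted n F ->
  \int[mu]_w (F w * H (w n.+1)) =
  \int[mu]_w (F w * \sum_y P (action pi n w) (w n) y * H y).
Proof.
move=> aF; have [_ muS] := muP.
pose f (h : history k n) := F (nth ord0 h).
have FE w : F w = f (past n w) by exact: adapted_past.
pose Y w := (past n w, w n.+1).
pose G (hy : history k n * 'I_k.+1) := f hy.1 * H hy.2.
have YE h y : Y @^-1` [set (h, y)] = [set w | past n w = h /\ w n.+1 = y].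
  by apply/seteqP; split => w; [case|move=> [wh wy]; rewrite /Y /= wh wy].
have mY hy : measurable (Y @^-1` [set hy]).
  case: hy => h y; rewrite YE.
  exact: measurableI (measurable_past h) (measurable_coordinate _ _).
pose K (h : history k n) :=
  f h * \sum_y P (pi h) (tnth h ord_max) y * H y.
have mpast (h : history k n) : measurable ((@past k n : trajectory k -> _) @^-1` [set h]).
  exact: measurable_past.
transitivity (\int[mu]_w G (Y w)); first by apply: eq_Rintegral => w _; rewrite FE.
transitivity (\int[mu]_w K (past n w)); last first.
  by apply: eq_Rintegral => w _; rewrite FE /K tnth_past_max.
rewrite (mean_finite mu G mY) (mean_finite mu K mpast).
pose S h y := G (h, y) * fine (mu (Y @^-1` [set (h, y)])).
transitivity (\sum_hy S hy.1 hy.2); first by apply: eq_bigr => -[].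
rewrite -(pair_bigA _ S) /S /=.
apply: eq_bigr => h _; rewrite /K mulrAC mulr_sumr; apply: eq_bigr => y _.
rewrite YE muS fineM ?fin_num_measure //; last exact: measurable_past.
by rewrite /G /=; ring.
Qed.

Lemma mean_start H : \int[mu]_w H (w 0%N) = H x.
Proof.
have m0 y : measurable ((fun w => w 0%N) @^-1` [set y]).
  exact: measurable_coordinate.
have [mu0 _] := muP.
have mux : fine (mu ((fun w => w 0%N) @^-1` [set x])) = 1.
  by rewrite (_ : mu _ = 1%E).
rewrite (mean_finite mu H m0); have := mean_finite mu (fun=> 1) m0.
rewrite mean_cst (bigD1 x) //= mux mul1r => /eqP.
rewrite addrC -subr_eq subrr eq_sym psumr_eq0 => [/allP other|y _]; last first.
  by rewrite mul1r fine_ge0.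
rewrite (bigD1 x) //= mux mulr1 big1 ?addr0 // => y yx.
have := other y (mem_index_enum _); rewrite yx mul1r => /eqP ->.
by rewrite mulr0.
Qed.

End process.

(** * Discounted rewards *)

Section rewards.
Variables (R : realType) (k l : nat) (c : 'I_k.+1 -> 'I_l.+1 -> R) (beta : R).
Hypotheses (beta_gt0 : 0 < beta) (beta_lt1 : beta < 1).
Variable pi : policy k l.
Implicit Types w : trajectory k.

Definition reward_upto n w : R :=
  \sum_(0 <= i < n) beta ^+ i * c (w i) (action pi i w).

Lemma reward_uptoS n w : reward_upto n.+1 w =
  reward_upto n w + beta ^+ n * c (w n) (action pi n w).
Proof. by rewrite /reward_upto big_nat_recr. Qed.

Lemma reward_upto_adapted n m : (n <= m.+1)%N ->
  adapted m (reward_upto n).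
Proof.
move=> nm w w' ww'; rewrite /reward_upto !big_mkord; apply: eq_bigr => i _.
have im : (i <= m)%N by rewrite -ltnS (leq_trans (ltn_ord i)).
by rewrite (action_adapted pi im ww') ww'.
Qed.

(** The constant is the geometric series of a crude bound on |c|. *)
Definition reward_bound : R := (\sum_z \sum_a `|c z a|) / (1 - beta).

Lemma reward_bound_ge0 : 0 <= reward_bound.
Proof.
rewrite divr_ge0 ?subr_ge0 ?(ltW beta_lt1) // sumr_ge0 // => z _.
by rewrite sumr_ge0.
Qed.

Lemma norm_reward_le z a : `|c z a| <= reward_bound * (1 - beta).
Proof.
rewrite divfK ?subr_eq0 ?gt_eqF // (bigD1 z) //= (bigD1 a) //= -addrA lerDl.
by rewrite addr_ge0 ?sumr_ge0 // => *; rewrite sumr_ge0.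
Qed.

(** The rewards collected between times n and m telescope against
beta^i - beta^(i+1). *)
Lemma reward_between n m w : (n <= m)%N ->
  `|reward_upto m w - reward_upto n w| <= reward_bound * (beta ^+ n - beta ^+ m).
Proof.
move=> /subnK <-; elim: (m - n)%N => [|d IH].
  by rewrite add0n !subrr normr0 mulr0.
rewrite addSn reward_uptoS addrAC (le_trans (ler_normD _ _)) //.
rewrite (_ : reward_bound * _ = reward_bound * (beta ^+ n - beta ^+ (d + n))
    + beta ^+ (d + n) * (reward_bound * (1 - beta))); last by rewrite exprS; ring.
rewrite lerD // normrM normrX (gtr0_norm beta_gt0).
by rewrite ler_wpM2l ?exprn_ge0 ?(ltW beta_gt0) // norm_reward_le.
Qed.

Lemma reward_upto_cvg w :
  reward_upto ^~ w @ \oo --> (total_reward c beta pi w : R^o).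
Proof.
suff : cvgn (series (fun i => beta ^+ i * c (w i) (action pi i w))) by [].
apply: normed_cvg; apply: (@series_le_cvg _ _
    (geometric (reward_bound * (1 - beta)) beta)) => //.
- by move=> n; exact: normr_ge0.
- move=> n; rewrite /geometric /= mulr_ge0 ?exprn_ge0 ?(ltW beta_gt0) //.
  by rewrite mulr_ge0 ?reward_bound_ge0 ?subr_ge0 ?(ltW beta_lt1).
- move=> n; rewrite /geometric /= normrM normrX (gtr0_norm beta_gt0) mulrC.
  by rewrite ler_wpM2r ?exprn_ge0 ?(ltW beta_gt0) // norm_reward_le.
- by apply: is_cvg_geometric_series; rewrite gtr0_norm.
Qed.

Lemma reward_tail n w :
  `|total_reward c beta pi w - reward_upto n w| <= reward_bound * beta ^+ n.
Proof.
have cv : (fun m => `|reward_upto m w - reward_upto n w|) @ \oo -->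
    `|total_reward c beta pi w - reward_upto n w|.
  by apply: cvg_norm; apply: cvgB; [exact: reward_upto_cvg|exact: cvg_cst].
rewrite -(cvg_lim _ cv) //; apply: limr_le; first by apply/cvg_ex; eexists; exact: cv.
near=> m; apply: (le_trans (@reward_between n m w _)).
  by near: m; exact: nbhs_infty_ge.
by rewrite ler_wpM2l ?reward_bound_ge0 // gerBl exprn_ge0 // ltW.
Unshelve. all: by end_near. Qed.

Lemma bounded_total_reward : bounded_rv (total_reward c beta pi : trajectory k -> R).
Proof.
split; last first.
  exists reward_bound => w; have := reward_tail 0 w.
  by rewrite /reward_upto big_geq // subr0 mulr1.
apply: (@measurable_fun_cvg _ _ _ setT reward_upto) => [n|w _].
  by have [] := bounded_adapted (@reward_upto_adapted n n (leqnSn n)).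
exact: reward_upto_cvg.
Qed.

End rewards.

(** * Exponential moments and the Bellman recursion *)

Section risk_sensitive.
Variables (R : realType) (k l : nat) (P : 'I_l.+1 -> 'M[R]_k.+1).
Hypothesis P_stochastic : stochastic P.
Variables (c : 'I_k.+1 -> 'I_l.+1 -> R) (beta : R).
Hypotheses (beta_gt0 : 0 < beta) (beta_lt1 : beta < 1).
Implicit Types (w : trajectory k) (H : 'I_k.+1 -> R) (f : 'I_k.+1 -> 'I_l.+1).
Implicit Types (pi : policy k l) (x y z : 'I_k.+1) (a : 'I_l.+1).

Local Notation S := (total_reward c beta).
Local Notation Sn := (reward_upto c beta).
Local Notation K := (reward_bound c beta).

Definition mgf (g : R) x pi : R :=
  \int[law P x pi]_w expR (g * total_reward c beta pi w).

(** The exponential moment of playing a once in z and then receiving H at the next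
state. *)
Definition bellman (g : R) H z a : R :=
  expR (g * c z a) * \sum_y P a z y * H y.

(** The exponential moment when the reward after time n is summarized by a
continuation value H of the current state. *)
Definition partial_mgf g x pi n H : R :=
  \int[law P x pi]_w (expR (g * reward_upto c beta pi n w) * H (w n)).

(** The bounds satisfied by the exponential moment at g of every policy.  They make
continuation values at g beta^n tend to 1, uniformly and multiplicatively. *)
Definition tame (g : R) H :=
  forall y, expR (- (`|g| * reward_bound c beta)) <= H y
            <= expR (`|g| * reward_bound c beta).

Lemma partial_mgf0 g x pi H : partial_mgf g x pi 0 H = H x.
Proof.
rewrite /partial_mgf -(mean_start P_stochastic pi x H).
apply: eq_Rintegral => w _.
by rewrite /reward_upto big_geq // mulr0 expR0 mul1r.
Qed.

Lemma expR_reward_upto_adapted g pi n m : (n <= m.+1)%N ->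
  adapted m (fun w => expR (g * reward_upto c beta pi n w)).
Proof. by move=> nm w w' ww'; rewrite (reward_upto_adapted c beta pi nm ww'). Qed.

Lemma partial_mgfS g x pi n H : partial_mgf g x pi n.+1 H =
  \int[law P x pi]_w (expR (g * reward_upto c beta pi n w) *
    bellman (g * beta ^+ n) H (w n) (action pi n w)).
Proof.
rewrite /partial_mgf mean_step //; last exact: expR_reward_upto_adapted.
apply: eq_Rintegral => w _; rewrite reward_uptoS mulrDr expRD -mulrA.
by rewrite mulrA [in RHS]/bellman -[in RHS]mulrA -[in LHS]mulrA (mulrA g).
Qed.

Lemma total_reward_le pi w : `|total_reward c beta pi w| <= reward_bound c beta.
Proof.
have := reward_tail c beta_gt0 beta_lt1 pi 0 w.
by rewrite /reward_upto big_geq // subr0 mulr1.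
Qed.

Lemma bounded_expR_total g pi :
  bounded_rv (fun w => expR (g * total_reward c beta pi w)).
Proof. exact/bounded_rv_expR/bounded_rvZ/bounded_total_reward. Qed.

Lemma mgf_tame g pi : tame g (fun x => mgf g x pi).
Proof.
move=> x.
have gS w : `|g * S pi w| <= `|g| * K.
  by rewrite normrM ler_wpM2l // total_reward_le.
have bg := bounded_expR_total g pi.
apply/andP; split;
  [rewrite -[leLHS](mean_cst (law P x pi))|rewrite -[leRHS](mean_cst (law P x pi))].
all: apply: le_mean => // [|w]; first exact: bounded_rv_cst.
all: by rewrite ler_expR; have := gS w; rewrite ler_norml => /andP[].
Qed.

Lemma mgf_gt0 g x pi : 0 < mgf g x pi.
Proof. by have /andP[+ _] := mgf_tame g pi x; apply: lt_le_trans; exact: expR_gt0. Qed.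

(** Both the reward after time n and the continuation value at g beta^n are within
a factor exp(|g| K beta^n) of 1, where K bounds the total reward. *)
Lemma partial_mgf_cvg g x pi (H : nat -> 'I_k.+1 -> R) :
  (forall n, tame (g * beta ^+ n) (H n)) ->
  (fun n => partial_mgf g x pi n (H n)) @ \oo --> mgf g x pi.
Proof.
move=> tH; pose d n := `|g| * K * 2 * beta ^+ n.
have d0 : d @ \oo --> (0 : R).
  rewrite -[X in _ --> X](mulr0 (`|g| * K * 2)); apply: cvgM; first exact: cvg_cst.
  by apply: cvg_expr; rewrite gtr0_norm.
have ed s : (fun n => expR (s * d n) * mgf g x pi) @ \oo --> mgf g x pi.
  rewrite -[X in _ --> X]mul1r -[X in X * _]expR0 -[X in expR X](mulr0 s).
  apply: cvgM; last exact: cvg_cst.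
  apply: continuous_cvg; first exact: continuous_expR.
  by apply: cvgM => //; exact: cvg_cst.
apply: squeeze_cvgr (ed (-1)) (ed 1).
near=> n.
have bn0 : 0 <= beta ^+ n by rewrite exprn_ge0 // ltW.
have bS : bounded_rv (fun w => expR (g * Sn pi n w)).
  exact: (bounded_adapted (@expR_reward_upto_adapted g pi n n (leqnSn n))).
have bH : bounded_rv (fun w : trajectory k => expR (g * Sn pi n w) * H n (w n)).
  apply: bounded_rvM => //.
  by apply: (@bounded_adapted _ _ n) => w w' ww'; rewrite ww'.
have bT := bounded_expR_total g pi.
rewrite /mgf -!meanZ //.
have key w : `|g * S pi w - g * Sn pi n w| <= `|g| * K * beta ^+ n.
  by rewrite -mulrBr normrM -mulrA ler_wpM2l // reward_tail.
have gn : `|g * beta ^+ n| * K = `|g| * K * beta ^+ n.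
  by rewrite normrM (ger0_norm bn0) mulrAC.
apply/andP; split; apply: le_mean => //; try exact: bounded_rvZ.
all: move=> w; have := key w; rewrite ler_norml => /andP[lo hi].
all: have := tH n (w n); rewrite gn => /andP[loH hiH].
  apply: le_trans (_ : expR (g * Sn pi n w) * expR (- (`|g| * K * beta ^+ n)) <= _).
    by rewrite -!expRD ler_expR /d; lra.
  by rewrite ler_wpM2l ?expR_ge0.
apply: le_trans (_ : expR (g * Sn pi n w) * expR (`|g| * K * beta ^+ n) <= _).
  by rewrite ler_wpM2l ?expR_ge0.
by rewrite -!expRD ler_expR /d; lra.
Unshelve. all: by end_near. Qed.

Lemma action_stationary f n w : action (stationary f) n w = f (w n).
Proof. by rewrite -[in RHS](tnth_past_max n w). Qed.

Fixpoint finite_horizon f n g z : R :=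
  if n is m.+1 then bellman g (finite_horizon f m (g * beta)) z (f z) else 1.

(** Each step moves one application of the Bellman operator from the continuation
value into the running reward. *)
Lemma partial_mgf_stationary f g x n m :
  partial_mgf g x (stationary f) n (finite_horizon f m (g * beta ^+ n)) =
  finite_horizon f (n + m) g x.
Proof.
elim: n m => [|n IH] m; first by rewrite partial_mgf0 mulr1.
rewrite addSnnS -IH partial_mgfS; apply: eq_Rintegral => w _.
by rewrite action_stationary /= -mulrA -exprSr.
Qed.

Lemma finite_horizon_cvg f g x :
  (fun n => finite_horizon f n g x) @ \oo --> mgf g x (stationary f).
Proof.
rewrite (_ : (fun n => _) = fun n => partial_mgf g x (stationary f) n (fun=> 1)).
  apply: partial_mgf_cvg => n y.
  rewrite -expR0 !ler_expR; have := reward_bound_ge0 c beta_lt1.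
  move=> K0; have := mulr_ge0 (normr_ge0 (g * beta ^+ n)) K0.
  by rewrite oppr_le0 => ->.
by apply/funext => n; rewrite -[n in LHS]addn0 -partial_mgf_stationary.
Qed.

(** The recursion is clear for finite horizons, and passes to the limit; this
avoids shifting the law of the process in time. *)
Lemma mgf_stationary f g x : mgf g x (stationary f) =
  bellman g (fun y => mgf (g * beta) y (stationary f)) x (f x).
Proof.
have cvS : (fun n => finite_horizon f n.+1 g x) @ \oo --> mgf g x (stationary f).
  by rewrite (cvg_shiftS (fun n => finite_horizon f n g x)); exact: finite_horizon_cvg.
apply: (cvg_unique _ cvS) => //=.
apply: cvgM; first exact: cvg_cst.
apply: cvg_big => [|y _]; first exact: add_continuous.
apply: cvgM; first exact: cvg_cst.
exact: finite_horizon_cvg.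
Qed.

(** The hypothesis makes s exp(g S_n) V_(g beta^n)(X_n) a supermartingale for pi,
starting at s V_g(x); its mean converges to s times the exponential moment.
Replacing s by - s gives the submartingale version. *)
Lemma verification s g x pi (V : R -> 'I_k.+1 -> R) :
  (forall n, tame (g * beta ^+ n) (V (g * beta ^+ n))) ->
  (forall n w, s * bellman (g * beta ^+ n) (V (g * beta ^+ n * beta))
                     (w n) (action pi n w) <= s * V (g * beta ^+ n) (w n)) ->
  s * mgf g x pi <= s * V g x.
Proof.
move=> tV sV; pose W n := partial_mgf g x pi n (V (g * beta ^+ n)).
have b1 n m : (n <= m.+1)%N -> bounded_rv (fun w => expR (g * Sn pi n w)).
  by move=> nm; exact: (bounded_adapted (@expR_reward_upto_adapted g pi n m nm)).
have b2 n (H : 'I_k.+1 -> 'I_l.+1 -> R) :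
    bounded_rv (fun w => H (w n) (action pi n w)).
  apply: (@bounded_adapted _ _ n) => w w' ww'.
  by rewrite ww' // (action_adapted pi (leqnn n) ww').
have Wle n : s * W n <= s * V g x.
  elim: n => [|n IH]; first by rewrite /W partial_mgf0 mulr1.
  apply: le_trans IH; rewrite /W partial_mgfS -!meanZ.
  - apply: le_mean.
    + apply: bounded_rvZ; apply: bounded_rvM; first exact: b1 (leqnSn n).
      exact: b2 (bellman _ _).
    + apply: bounded_rvZ; apply: bounded_rvM; first exact: b1 (leqnSn n).
      exact: b2 (fun z _ => V _ z).
    + move=> w; rewrite mulrCA [leRHS]mulrCA ler_wpM2l ?expR_ge0 //.
      by rewrite exprSr mulrA sV.
  - apply: bounded_rvM; first exact: b1 (leqnSn n).
    exact: b2 (fun z _ => V _ z).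
  - apply: bounded_rvM; first exact: b1 (leqnSn n).
    exact: b2 (bellman _ _).
have cv : (fun n => s * W n) @ \oo --> s * mgf g x pi.
  by apply: cvgM; [exact: cvg_cst|exact: partial_mgf_cvg].
rewrite -(cvg_lim _ cv) //; apply: limr_le; first by apply/cvg_ex; eexists; exact: cv.
by apply: nearW.
Qed.

End risk_sensitive.

(** * Policy improvement for small risk parameters *)

Section one_sided.
Variables (R : realType) (k l : nat) (P : 'I_l.+1 -> 'M[R]_k.+1).
Hypothesis P_stochastic : stochastic P.
Variables (c : 'I_k.+1 -> 'I_l.+1 -> R) (beta : R).
Hypotheses (beta_gt0 : 0 < beta) (beta_lt1 : beta < 1).
Variable s : R.
Hypothesis s_sign : `|s| = 1.
Implicit Types (f : {ffun 'I_k.+1 -> 'I_l.+1}) (x y z : 'I_k.+1) (a : 'I_l.+1).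

Local Notation G g f := (fun y => mgf P c beta g y (stationary f)).
Local Notation bell := (bellman P c).

(** The gain, measured with the sign of the risk parameter, from playing a once in
x before following f. *)
Definition advantage f x a t : R :=
  s * bell (s * t) (G (s * t * beta) f) x a - s * G (s * t) f x.

Lemma near0_dilate (Q : R -> Prop) :
  (\forall t \near 0^'+, Q t) ->
  \forall t \near 0^'+, forall n, Q (t * beta ^+ n).
Proof.
move=> /near_rightP[e e0 eQ]; apply/near_rightP; exists e => // t /andP[t0 te] n.
have bn : 0 < beta ^+ n by rewrite exprn_gt0.
apply: eQ; rewrite mulr_gt0 //= (le_trans _ te) // ler_piMr ?(ltW t0) //.
by rewrite exprn_ile1 // ltW.
Qed.

(** Dividing by exp(s t c(x, a)) turns the advantage into a linear combination of
exponential moments of bounded variables, which is analytic in t. *)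
Lemma advantage_sign f x a :
  (\forall t \near 0^'+, advantage f x a t <= 0) \/
  (\forall t \near 0^'+, 0 < advantage f x a t).
Proof.
pose D t := \sum_y (s * P a x y) * G (s * beta * t) f y +
  - s * \int[law P x (stationary f)]_w
    expR (s * t * (total_reward c beta (stationary f) w - c x a)).
have bS := bounded_total_reward c beta_gt0 beta_lt1 (stationary f).
have DE t : advantage f x a t = expR (s * t * c x a) * D t.
  rewrite /advantage /D /bellman mulrDr; congr (_ + _).
    rewrite mulrCA; congr (_ * _); rewrite mulr_sumr; apply: eq_bigr => y _.
    by rewrite mulrA (mulrAC s t).
  rewrite mulrCA mulNr; congr (- (_ * _)); rewrite -meanZ.
    by apply: eq_Rintegral => w _; rewrite -expRD; congr expR; ring.
  apply/bounded_rv_expR/bounded_rvZ/bounded_rvB => //; exact: bounded_rv_cst.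
have [D0|D0] : (\forall t \near 0^'+, D t <= 0) \/ (\forall t \near 0^'+, 0 < D t).
- apply: expandable_sign.
  have [a1 Ha1] : expandable (fun t => \sum_y (s * P a x y) * G (s * beta * t) f y).
    apply: expandable_sum => y; eexists; apply: expandsZ.
    apply: (@expands_dilate _ (s * beta) (fun g => G g f y)).
      by rewrite normrM s_sign mul1r gtr0_norm // ltW.
    exact: mgf_expands.
  eexists; apply: expandsD Ha1 _; apply: expandsZ.
  apply: (@expands_dilate _ s (fun g => \int[law P x (stationary f)]_w
      expR (g * (total_reward c beta (stationary f) w - c x a)))).
    by rewrite s_sign.
  by apply/mgf_expands/bounded_rvB => //; exact: bounded_rv_cst.
- by left; apply: filterS D0 => t Dt; rewrite DE pmulr_rle0 ?expR_gt0.
- by right; apply: filterS D0 => t Dt; rewrite DE pmulr_rgt0 ?expR_gt0.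
Qed.

Definition eventually_le f f' := \forall t \near (0 : R)^'+,
  forall x, s * G (s * t) f x <= s * G (s * t) f' x.

Lemma eventually_le_refl f : eventually_le f f.
Proof. exact: nearW. Qed.

Lemma eventually_le_trans f1 f2 f3 :
  eventually_le f1 f2 -> eventually_le f2 f3 -> eventually_le f1 f3.
Proof. by apply: filterS2 => t H1 H2 x; exact: le_trans (H2 x). Qed.

(** A policy with the largest number of policies below it. *)
Lemma eventually_maximal :
  exists f, forall f', eventually_le f f' -> eventually_le f' f.
Proof.
pose below f := [set f' | `[< eventually_le f' f >]]%SET.
pose f0 : {ffun 'I_k.+1 -> 'I_l.+1} := [ffun=> ord0].
case: (@arg_maxnP _ f0 xpredT (fun f => #|below f|) isT) => f _ fmax.
exists f => f' ff'.
have sub : (below f \subset below f')%SET.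
  apply/fintype.subsetP => g; rewrite !inE => gf.
  exact: eventually_le_trans gf ff'.
have /eqP e : below f == below f' by rewrite eqEcard sub; exact: fmax.
have : f' \in below f by rewrite e !inE; exact: eventually_le_refl.
by rewrite !inE.
Qed.

Definition switch f x a : {ffun 'I_k.+1 -> 'I_l.+1} :=
  [ffun z => if z == x then a else f z].

(** The value of f is a sub-solution of the Bellman recursion of the switched
policy: strictly so in x, with equality elsewhere. *)
Lemma improvement f x a :
  (\forall t \near 0^'+, 0 < advantage f x a t) ->
  eventually_le f (switch f x a).
Proof.
move=> /near0_dilate; apply: filterS => t adv z.
(* Verification for the opposite sign, with the value of f as V. *)
rewrite -lerN2 -!mulNr; apply: (@verification _ _ _ _ P_stochastic c _
  beta_gt0 beta_lt1 _ _ _ _ (fun g => G g f)) => [n|n w]; first exact: mgf_tame.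
rewrite action_stationary ffunE; case: eqP => [->|_].
  by have := adv n; rewrite /advantage mulrA; lra.
by rewrite -mgf_stationary.
Qed.

(** If some advantage of a maximal f were eventually positive, the switched policy
would be above f, hence have the same germs as f; but then its own recursion at
the switched state says that the advantage is zero. *)
Lemma eventually_optimal_equation :
  exists f, \forall t \near 0^'+, forall x a, advantage f x a t <= 0.
Proof.
have [f fmax] := eventually_maximal; exists f.
apply: filter_forall => x; apply: filter_forall => a.
have [//|adv] := advantage_sign f x a.
have le1 := improvement adv.
have le2 := fmax _ le1.
have eqG : \forall t \near 0^'+, forall y,
    s * G (s * t) f y = s * G (s * t) (switch f x a) y.
  by apply: filterS2 le1 le2 => t H1 H2 y; apply/eqP; rewrite eq_le H1 H2.
exfalso; have [t [/= + eqt]] := filter_ex (filterI adv (near0_dilate eqG)).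
have s0 : s != 0 by rewrite -normr_eq0 s_sign oner_eq0.
have eq0 y : G (s * t) f y = G (s * t) (switch f x a) y.
  by apply: (mulfI s0); have := eqt 0%N y; rewrite mulr1.
have eq1 : G (s * t * beta) f = G (s * t * beta) (switch f x a).
  apply/funext => y; apply: (mulfI s0).
  by have := eqt 1%N y; rewrite expr1 mulrA.
rewrite /advantage eq0 eq1 [X in _ - s * X](mgf_stationary P_stochastic) //.
by rewrite ffunE eqxx subrr ltxx.
Qed.

Lemma eventually_optimal : exists f, \forall t \near 0^'+, forall x pi,
  s * mgf P c beta (s * t) x pi <= s * G (s * t) f x.
Proof.
have [f /near0_dilate adv] := eventually_optimal_equation; exists f.
apply: filterS adv => t adv x pi.
apply: (@verification _ _ _ _ P_stochastic c _
  beta_gt0 beta_lt1 _ _ _ _ (fun g => G g f)) => [n|n w]; first exact: mgf_tame.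
by have := adv n (w n) (action pi n w); rewrite /advantage subr_le0 mulrA.
Qed.

Lemma J_risk_neutral x (pi : policy k l) :
  J P c 0 x pi beta = \int[law P x pi]_w total_reward c beta pi w.
Proof. by rewrite /J eqxx unlock. Qed.

Lemma J_risk_sensitive g x (pi : policy k l) : g != 0 ->
  J P c g x pi beta = g^-1 * ln (mgf P c beta g x pi).
Proof. by move=> /negbTE g0; rewrite /J g0 unlock. Qed.

(** The exponential moments agree at t = 0, and s times their derivative there is
the mean since s^2 = 1. *)
Lemma mean_le_of_mgf_le x (pi pi' : policy k l) :
  (\forall t \near 0^'+,
     s * mgf P c beta (s * t) x pi <= s * mgf P c beta (s * t) x pi') ->
  \int[law P x pi]_w total_reward c beta pi w <=
  \int[law P x pi']_w total_reward c beta pi' w.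
Proof.
move=> H.
have Es p : expands (fun t => mgf P c beta (s * t) x p)
    (fun j => \int[law P x p]_w (total_reward c beta p w ^+ j) / j`!%:R * s ^+ j).
  apply: (@expands_dilate _ s (fun g => mgf P c beta g x p)).
    by rewrite s_sign.
  exact: (mgf_expands (law P x p) (bounded_total_reward c beta_gt0 beta_lt1 p)).
have := expands_slope_ge0 (expandsD (expandsZ s (Es pi')) (expandsZ (- s) (Es pi))).
rewrite !expr0 !mean_cst mulNr subrr => /(_ erefl).
rewrite !expr1 !divr1 mulNr -mulrBr -mulrBl mulrCA -expr2 -real_normK ?num_real //.
rewrite s_sign expr1n mulr1 subr_ge0; apply; apply: filterS H => t.
by rewrite mulNr subr_ge0.
Qed.

Lemma eventually_optimal_policy : exists f, exists2 e, 0 < e &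
  forall t, 0 <= t <= e -> optimal_markov P c beta (s * t) (stationary f).
Proof.
have [f H] := eventually_optimal; have /near_rightP[e e0 eH] := H.
exists f, e => // t /andP[t0 te]; split; first by exists (fun=> f).
move=> x; apply/eqP; rewrite eq_le; apply/andP; split.
  by apply: ereal_sup_ubound; exists (stationary f).
apply: ge_ereal_sup => _ [pi _ <-]; rewrite lee_fin.
move: t0; rewrite le_eqVlt => /predU1P[<-|t0].
  rewrite mulr0 !J_risk_neutral; apply: mean_le_of_mgf_le.
  by apply: filterS H => t' /(_ x pi).
have Ht : s * mgf P c beta (s * t) x pi <= s * G (s * t) f x.
  by apply: eH; rewrite t0.
have s0 : s != 0 by rewrite -normr_eq0 s_sign oner_eq0.
have st0 : s * t != 0 by rewrite mulf_neq0 // gt_eqF.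
rewrite !(J_risk_sensitive _ _ st0) invfM -!mulrA.
have sV : s^-1 = s.
  by apply: (mulfI s0); rewrite divff // -expr2 -real_normK ?num_real // s_sign expr1n.
rewrite sV mulrCA [leRHS]mulrCA ler_pM2l ?invr_gt0 //.
have [sp|sn] : 0 < s \/ s < 0 by case: (ltgtP s 0) s0 => //; [right|left].
- rewrite ler_pM2l // in Ht.
  by rewrite ler_pM2l // ler_ln // posrE; exact: mgf_gt0.
- rewrite ler_nM2l // in Ht.
  by rewrite ler_nM2l // ler_ln // posrE; exact: mgf_gt0.
Qed.

End one_sided.

Theorem theorem4p1 (R : realType) (k l : nat)
    (P : 'I_l.+1 -> 'M[R]_k.+1) (P_stochastic : stochastic P)
    (c : 'I_k.+1 -> 'I_l.+1 -> R)
    (beta : R) (beta_gt0 : 0 < beta) (beta_lt1 : beta < 1) :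
  (exists (gamma_beta : R) (u : 'I_k.+1 -> 'I_l.+1),
     gamma_beta < 0 /\
     forall gamma : R, gamma_beta <= gamma <= 0 ->
       optimal_markov P c beta gamma (stationary u)) /\
  (exists (gamma_beta : R) (u : 'I_k.+1 -> 'I_l.+1),
     0 < gamma_beta /\
     forall gamma : R, 0 <= gamma <= gamma_beta ->
       optimal_markov P c beta gamma (stationary u)).
Proof.
split.
- have [|f [e e0 opt]] := @eventually_optimal_policy _ _ _ _ P_stochastic c _
    beta_gt0 beta_lt1 (-1); first by rewrite normrN1.
  exists (- e), f; split=> [|gamma /andP[eg g0]]; first by rewrite oppr_lt0.
  by have := opt (- gamma); rewrite mulN1r opprK; apply; rewrite oppr_ge0 g0 lerNl.
- have [|f [e e0 opt]] := @eventually_optimal_policy _ _ _ _ P_stochastic c _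
    beta_gt0 beta_lt1 1; first by rewrite normr1.
  exists e, f; split=> // gamma ge.
  by have := opt gamma ge; rewrite mul1r.
Qed.
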